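(* Let $Q$ be a quiver associated to an antisymmetric integer matrix $(\kappa_{ij})_{1\le i,j\le n}$. Assume that $Q$ admits an R-charge and that $Q$ contains a simple oriented cycle passing through all the nodes; label the nodes so that this cycle is $1\to 2\to\cdots\to n\to 1$. If $Q$ admits a scaling solution or an attractor solution, then $$\sum_{i<j}\kappa_{ij}\ge 0$$ and the same holds for all cyclic permutations, i.e. for each $r\in\{1,\dots,n\}$ the inequality holds when $<$ is replaced by the total order $r<r+1<\dots<n<1<\dots<r-1$ on $\{1,\dots,n\}$.
   Context: Let $\kappa=(\kappa_{ij})_{1\le i,j\le n}$ be an antisymmetric matrix of integers. The associated quiver $Q$ has set of nodes $Q_0=\{1,\dots,n\}$ and, for each pair $(i,j)$ with $\kappa_{ij}>0$, exactly $\kappa_{ij}$ arrows from $i$ to $j$. $Q_1$ is the set of arrows and $Q_2$ the set of simple oriented cycles, i.e. oriented cycles passing at most once through each node. An R-charge is a map $R:Q_1\to\mathbb{R}$ such that $\sum_{a\in w}R(a)=2$ for every $w\in Q_2$. A configuration of centers is a family of points $\vec r_1,\dots,\vec r_n\in\mathbb{R}^3$ with $\vec r_i\ne \vec r_j$ whenever $\kappa_{ij}\neq 0$; write $r_{ij}=|\vec r_i-\vec r_j|$. Terms with $\kappa_{ij}=0$ are omitted from the sums below. A scaling solution is a configuration satisfying $\sum_{j\ne i}\kappa_{ij}/r_{ij}=0$ for all $i=1,\dots,n$. An attractor solution is a configuration satisfying $\sum_{j\neq i}\kappa_{ij}\left(1+1/r_{ij}\right)=0$ for all $i=1,\dots,n$.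 *)

(* Defs.v *)
From HB Require Import structures.
From mathcomp Require Import all_boot all_order all_algebra.
From mathcomp Require Import reals.

Set Implicit Arguments.
Unset Strict Implicit.
Unset Printing Implicit Defensive.

Import Order.TTheory GRing.Theory Num.Theory.
Local Open Scope ring_scope.

Definition antisymmetric_mx (n : nat) (kappa : 'M[int]_n) : Prop :=
  forall i j : 'I_n, kappa i j = - kappa j i.

Section Quiver.

Variables (n : nat) (kappa : 'M[int]_n).

Definition multiplicity (i j : 'I_n) : nat :=
  if 0 < kappa i j then `|kappa i j|%N else 0%N.

(* An arrow i -> j is the pair (i, j) tagged by a number below the           *)
(* multiplicity, so that parallel arrows are distinct.                       *)
Definition arrow : Type :=
  {p : 'I_n * 'I_n & 'I_(multiplicity p.1 p.2)}.

Definition source (a : arrow) : 'I_n := (tag a).1.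
Definition target (a : arrow) : 'I_n := (tag a).2.

Definition oriented_cycle (w : seq arrow) : bool :=
  (w != [::]) && cycle (fun a b => target a == source b) w.

(* A cycle is represented by the list of its arrows from a chosen base       *)
(* point; rotations of the list represent the same cycle.                    *)
Definition simple_cycle (w : seq arrow) : bool :=
  oriented_cycle w && uniq [seq source a | a <- w].

(* There is a simple oriented cycle through all the nodes, visiting them in  *)
(* the order of their labels.                                                *)
Definition labelled_hamiltonian : Prop :=
  exists2 w : seq arrow,
    simple_cycle w & [seq source a | a <- w] = enum 'I_n.

Definition is_Rcharge (R : realType) (rho : arrow -> R) : Prop :=
  forall w : seq arrow, simple_cycle w -> \sum_(a <- w) rho a = 2.

(* Euclidean distance; the norm supplied by MathComp-Analysis on row vectors *)
(* is the sup norm.                                                          *)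
Definition edist (R : realType) (x y : 'rV[R]_3) : R :=
  Num.sqrt (\sum_(k < 3) (x 0 k - y 0 k) ^+ 2).

Definition configuration (R : realType) (r : 'I_n -> 'rV[R]_3) : Prop :=
  forall i j : 'I_n, kappa i j != 0 -> r i != r j.

Definition scaling_solution (R : realType) (r : 'I_n -> 'rV[R]_3) : Prop :=
  configuration r /\
  forall i : 'I_n,
    \sum_(j < n | (j != i) && (kappa i j != 0))
       (kappa i j)%:~R * (edist (r i) (r j))^-1 = 0.

Definition attractor_solution (R : realType) (r : 'I_n -> 'rV[R]_3) : Prop :=
  configuration r /\
  forall i : 'I_n,
    \sum_(j < n | (j != i) && (kappa i j != 0))
       (kappa i j)%:~R * (1 + (edist (r i) (r j))^-1) = 0.

End Quiver.

(* The order r < r+1 < ... < n-1 < 0 < ... < r-1 on 'I_n: nodes are compared *)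
(* by their position (i - r) mod n after r.                                  *)
Definition cyclic_lt (n : nat) (r i j : 'I_n) : bool :=
  ((i + (n - r)) %% n < (j + (n - r)) %% n)%N.

(* Main.v *)
(* Closing an edge up along the Hamiltonian cycle shows that, up to a         *)
(* coboundary, the R-charge of an edge is 2 if it goes backward for the       *)
(* chosen cyclic order and 0 otherwise. Hence every simple cycle has exactly  *)
(* one backward edge. A solution turns kappa into a conserved flow phi with   *)
(* kappa = phi d, where d is the Euclidean distance r for scaling solutions   *)
(* and r / (1 + r) for attractor solutions; both satisfy the triangle         *)
(* inequality. Give an edge the weight d if it is forward and - d if it is    *)
(* backward: the triangle inequality makes all simple cycles nonnegative, so  *)
(* there is a potential v with v_i <= c_ij + v_j along edges. Since phi is    *)
(* orthogonal to coboundaries, the sum of phi c over the edges, which is the  *)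
(* sum to be bounded, is nonnegative.                                         *)
Require Import Defs.
From HB Require Import structures.
From mathcomp Require Import all_boot all_order all_algebra.
From mathcomp Require Import reals ring lra zify.

Set Implicit Arguments.
Unset Strict Implicit.
Unset Printing Implicit Defensive.

Import Order.TTheory GRing.Theory Num.Theory.
Local Open Scope ring_scope.

(** The inequality is a weak duality between a flow and a potential. For a fixed cyclic order,
    [Rcharge_cyclic] writes the R-charge of an edge as a coboundary plus 2 on backward edges; closed
    paths kill the coboundary, so each simple cycle has exactly one backward edge. By
    [one_backward_ge] the signed lengths, [d] forward and [- d] backward, then have a nonnegative
    sum on every simple cycle, and [feasible_potential] turns this into a potential.
    [flow_cyclic_sum_ge0] pairs it with the conserved flow [kappa i j * u i j], where [u] is inverse
    to [d] on edges. *)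

Lemma cycle_nth (T : Type) (e : rel T) x0 p k :
  cycle e p -> (k < size p)%N -> e (nth x0 p k) (nth x0 p (k.+1 %% size p)).
Proof.
case: p => [//|x p] /= /(pathP x0) ep lt_k.
have := ep k; rewrite size_rcons => /(_ lt_k).
rewrite -rcons_cons nth_rcons /= lt_k nth_rcons.
rewrite ltnS leq_eqVlt in lt_k; case/predU1P: lt_k => [->|lt_kp].
  by rewrite ltnn eqxx modnn.
by rewrite lt_kp modn_small.
Qed.

(** * Path weights and shortest-path potentials *)

Section PathWeight.

Variables (R : realFieldType) (T : eqType).
Implicit Types (c d : T -> T -> R) (x y : T) (p q : seq T).

Fixpoint path_weight c x p : R :=
  if p is y :: q then c x y + path_weight c y q else 0.

Lemma path_weight_cat c x p q :
  path_weight c x (p ++ q) = path_weight c x p + path_weight c (last x p) q.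
Proof. by elim: p x => [|y p IHp] x /=; rewrite ?add0r // IHp addrA. Qed.

Lemma path_weight_rcons c x p y :
  path_weight c x (rcons p y) = path_weight c x p + c (last x p) y.
Proof. by rewrite -cats1 path_weight_cat /= addr0. Qed.

Lemma path_weight_coboundary (e : rel T) (c b : T -> T -> R) (X : T -> R) x p :
  (forall y z, e y z -> c y z = X z - X y + b y z) ->
  path e x p ->
  path_weight c x p = X (last x p) - X x + path_weight b x p.
Proof.
move=> cE; elim: p x => [|y p IHp] x /=; first by rewrite subrr addr0.
by case/andP=> exy epy; rewrite (cE _ _ exy) (IHp _ epy); ring.
Qed.

(** Knowing that the count is a natural number lets a vanishing total exclude every marked edge. *)
Lemma path_weight_nat (b : T -> T -> bool) x p :
  exists k : nat, path_weight (fun y z => (b y z)%:R) x p = k%:R.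
Proof.
elim: p x => [|y p IHp] x /=; first by exists 0%N.
by have [k ->] := IHp y; exists (b x y + k)%N; rewrite natrD.
Qed.

End PathWeight.

(* The potential is the least weight of a simple path issued from a node:    *)
(* prepending an edge to a simple path either keeps it simple or closes a    *)
(* simple cycle, which can be dropped as its weight is nonnegative.          *)
Lemma feasible_potential (R : realFieldType) (T : finType) (e : rel T)
    (c : T -> T -> R) :
  (forall x p, path e x p -> last x p = x -> uniq p ->
     0 <= path_weight c x p) ->
  exists v : T -> R, forall x y, e x y -> v x <= c x y + v y.
Proof.
move=> c_ge0.
(* Bounded sequences form a finite type, so a minimum over simple paths exists. *)
pose P x (p : {bseq #|T| of T}) := path e x p && uniq (x :: p).
have P0 x : P x [bseq] by [].
have PE x p : path e x p -> uniq (x :: p) -> exists2 q, P x q & q = p :> seq T.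
  move=> ep up; have sp : (size p <= #|T|)%N.
    by move/card_uniqP: (up) (max_card (mem (x :: p))) => -> /ltnW.
  by exists (Bseq sp) => //; rewrite /P ep up.
pose m x := [arg min_(p < [bseq] | P x p) path_weight c x p]%O.
have mP x : P x (m x) /\ forall p, P x p ->
    path_weight c x (m x) <= path_weight c x p.
  by rewrite /m; case: arg_minP => // p Pp minp.
exists (fun x => path_weight c x (m x)) => x y exy.
have [/andP[]] := mP y; move: (m y : seq T) => p ep up _.
have [_ min_x] := mP x.
have [|xNyp] := boolP (x \in y :: p); last first.
  have [||q Pq qE] := PE x (y :: p); first by rewrite /= exy.
    by rewrite cons_uniq xNyp.
  by have := min_x q Pq; rewrite qE.
move=> x_yp; case/splitPl: x_yp ep up => p1 p2 lastE.
rewrite -cat_cons cat_uniq cat_path lastE => /andP[ep1 ep2] /and3P[up1 disj up2].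
have xp1 : x \in y :: p1 by rewrite -lastE mem_last.
have [//||q Pq qE] := PE x p2.
  rewrite /= up2 andbT; apply: contra disj => xp2.
  by apply/hasP; exists x.
have := min_x q Pq; rewrite qE path_weight_cat lastE => le_p2.
have := c_ge0 x (y :: p1); rewrite /= exy lastE => /(_ ep1 erefl up1).
lra.
Qed.

(** * Paths with one backward edge *)

Section Triangle.

Variables (R : realFieldType) (T : eqType) (d : T -> T -> R).
Hypotheses (dxx : forall x, d x x = 0) (dC : forall x y, d x y = d y x).
Hypothesis dD : forall x y z, d x z <= d x y + d y z.

Lemma triangle_path x p : d x (last x p) <= path_weight d x p.
Proof.
elim: p x => [|y p IHp] x /=; first by rewrite dxx.
by apply: le_trans (dD _ y _) _; rewrite lerD2l.
Qed.

(** The backward edge, from [y] to [z], is no longer than the detour from [y] back to the start,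
    across to the end of the path, and back to [z]. The forward edges pay for the first and last
    legs. *)
Lemma one_backward_ge (b : T -> T -> bool) x p :
  path_weight (fun y z => (b y z)%:R) x p = 1 :> R ->
  - d x (last x p)
    <= path_weight (fun y z => if b y z then - d y z else d y z) x p.
Proof.
elim: p x => [|y p IHp] x /=; first by move/eqP; rewrite eq_sym oner_eq0.
case: (b x y) => /= [|]; last first.
  rewrite add0r => /IHp.
  by have := dD y x (last y p); rewrite (dC y x) => *; lra.
rewrite -[RHS]addr0 => /addrI b0.
(* The single backward edge has just been used, so the rest of the path is all forward. *)
suff -> : path_weight (fun y z => if b y z then - d y z else d y z) y p
          = path_weight d y p.
  have := triangle_path y p; have := dD x (last y p) y; rewrite (dC (last y p) y) => *; lra.
elim: p y b0 {IHp} => //= z p IHp y.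
have [k kE] := path_weight_nat R b z p.
by rewrite kE -natrD => /eqP; rewrite pnatr_eq0 addn_eq0; case: (b y z) => //=
  /eqP k0; rewrite IHp // kE k0.
Qed.

End Triangle.

(** * Euclidean distance *)

Lemma edistxx (R : realType) (x : 'rV[R]_3) : edist x x = 0.
Proof. by rewrite /edist big1 ?sqrtr0 // => k _; rewrite subrr expr0n. Qed.

Lemma edistC (R : realType) (x y : 'rV[R]_3) : edist x y = edist y x.
Proof. by congr Num.sqrt; apply: eq_bigr => k _; ring. Qed.

Lemma edist_ge0 (R : realType) (x y : 'rV[R]_3) : 0 <= edist x y.
Proof. exact: sqrtr_ge0. Qed.

Lemma edist_gt0 (R : realType) (x y : 'rV[R]_3) : x != y -> 0 < edist x y.
Proof.
move=> neq_xy; rewrite sqrtr_gt0 lt_def sumr_ge0 ?andbT => [|k _]; last first.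
  exact: sqr_ge0.
apply: contra neq_xy => /eqP/psumr_eq0P xy0; apply/eqP/rowP => k.
have /eqP := xy0 (fun k _ => sqr_ge0 _) k isT.
by rewrite sqrf_eq0 subr_eq0 => /eqP.
Qed.

Lemma edist_triangle (R : realType) (x y z : 'rV[R]_3) :
  edist x z <= edist x y + edist y z.
Proof.
rewrite -[leRHS]ger0_norm ?addr_ge0 ?edist_ge0 // -sqrtr_sqr ler_wsqrtr //.
rewrite sqrrD !sqr_sqrtr ?sumr_ge0 // => [|k _|k _]; try exact: sqr_ge0.
rewrite -sqrtrM ?sumr_ge0 // => [|k _]; last exact: sqr_ge0.
rewrite !big_ord_recl !big_ord0.
set x0 := x 0 _; set x1 := x 0 _; set x2 := x 0 _.
set y0 := y 0 _; set y1 := y 0 _; set y2 := y 0 _.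
set z0 := z 0 _; set z1 := z 0 _; set z2 := z 0 _.
set s := (X in Num.sqrt X).
set t := (x0 - y0) * (y0 - z0) + (x1 - y1) * (y1 - z1) + (x2 - y2) * (y2 - z2).
have le_ts : t <= Num.sqrt s.
  apply: le_trans (ler_norm _) _; rewrite -sqrtr_sqr ler_wsqrtr //.
  (* Cauchy-Schwarz by Lagrange's identity. *)
  rewrite -subr_ge0; have -> : s - t ^+ 2 =
      ((x0 - y0) * (y1 - z1) - (x1 - y1) * (y0 - z0)) ^+ 2
    + ((x0 - y0) * (y2 - z2) - (x2 - y2) * (y0 - z0)) ^+ 2
    + ((x1 - y1) * (y2 - z2) - (x2 - y2) * (y1 - z1)) ^+ 2.
    by rewrite /s /t; ring.
  by rewrite !addr_ge0 ?sqr_ge0.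
move: (Num.sqrt s) le_ts => u le_ts; by rewrite /t in le_ts; lra.
Qed.

(** * R-charges along paths of nodes *)

Section ArrowPaths.

Variables (R : realType) (n : nat) (kappa : 'M[int]_n).
Variable rho : arrow kappa -> R.

Local Notation edge := (fun i j => 0 < kappa i j).

(* Parallel arrows are represented by the one numbered 0. *)
Definition edge_charge (i j : 'I_n) : R :=
  if insub 0%N is Some t
  then rho (existT (fun p => 'I_(multiplicity kappa p.1 p.2)) (i, j) t) else 0.

Lemma arrow_edge (a : arrow kappa) : edge (source a) (target a).
Proof.
by case: a => -[i j] [t] /=; rewrite /source /target /multiplicity /=; case: ifP.
Qed.

Lemma path_arrows i p : path edge i p ->
  exists w : seq (arrow kappa),
    [/\ map (@source _ _) w = belast i p, map (@target _ _) w = p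
      & \sum_(a <- w) rho a = path_weight edge_charge i p].
Proof.
elim: p i => [|j p IHp] i /=; first by exists [::]; rewrite big_nil.
case/andP=> kij /IHp[w [ws wt wE]].
have m_gt0 : (0 < multiplicity kappa i j)%N.
  by rewrite /multiplicity kij absz_gt0 gt_eqF.
pose a : arrow kappa :=
  existT (fun p => 'I_(multiplicity kappa p.1 p.2)) (i, j) (Ordinal m_gt0).
exists (a :: w); rewrite big_cons /= ws wt wE; split=> //.
congr (_ + _); rewrite /edge_charge.
by case: insubP => [t _ t0|]; [congr rho; congr existT; apply: val_inj | rewrite m_gt0].
Qed.

Lemma cycle_arrows (w : seq (arrow kappa)) :
  map (@target _ _) w = rot 1 (map (@source _ _) w) ->
  cycle (fun a b => target a == source b) w.
Proof.
case: w => // a w; rewrite map_cons rot1_cons /=.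
suff gen b c : target b :: map (@target _ _) w
    = rcons (map (@source _ _) w) (source c) ->
    path (fun a b => target a == source b) b (rcons w c) by exact: gen.
elim: w b => [|a' w IHw] b /=; first by case=> ->; rewrite eqxx.
by case=> -> /IHw ->; rewrite eqxx.
Qed.

(** The sources of the lifted arrows are a rotation of [p], so [uniq p] makes the lifted cycle
    simple. *)
Lemma Rcharge_closed_path i p : is_Rcharge rho ->
  path edge i p -> last i p = i -> uniq p -> p != [::] ->
  path_weight edge_charge i p = 2.
Proof.
move=> rhoP ep; have [w [ws wt <-]] := path_arrows ep.
case: p / lastP ep ws wt => // p j _.
rewrite belast_rcons last_rcons rcons_uniq => ws wt ji up _; apply: rhoP.
rewrite /simple_cycle /oriented_cycle ws /= -{1}ji up andbT.
rewrite cycle_arrows ?wt ?ws ?rot1_cons ?ji // andbT.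
by apply: contra_eqN ws => /eqP->.
Qed.

End ArrowPaths.

(** An edge from [i] to [j] closes up into a simple cycle with the stretch of the Hamiltonian cycle
    from [j] to [i]; the total charge 2 then determines the charge of the edge. *)
Lemma Rcharge_cyclic (R : realType) (m : nat) (kappa : 'M[int]_m.+1)
    (rho : arrow kappa -> R) (r : 'I_m.+1) :
  antisymmetric_mx kappa -> is_Rcharge rho -> labelled_hamiltonian kappa ->
  exists X : 'I_m.+1 -> R, forall i j, 0 < kappa i j ->
    edge_charge rho i j = X j - X i + 2 * (cyclic_lt r j i)%:R.
Proof.
move=> kA rhoP [w /andP[/andP[_ cw] _] wE].
(* The Hamiltonian cycle unrolled along the natural numbers; [X] below accumulates the charge along
   it. *)
pose f k : 'I_m.+1 := inZp k.
have ef k : 0 < kappa (f k) (f k.+1).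
  have ce : cycle (fun i j => 0 < kappa i j) (enum 'I_m.+1).
    rewrite -wE cycle_map; apply: sub_cycle cw => a b /eqP ab /=.
    by rewrite -ab arrow_edge.
  have := cycle_nth ord0 ce; rewrite size_enum_ord => /(_ (k %% m.+1)%N).
  rewrite ltn_pmod // => /(_ isT).
  set i := nth _ _ _; set j := nth _ _ _.
  suff [-> ->] : i = f k /\ j = f k.+1 by [].
  by split; apply: val_inj; rewrite /= nth_enum_ord ?ltn_pmod // -addn1 modnDml addn1.
pose X k : R := \sum_(t < k) edge_charge rho (f t) (f t.+1).
have XE l a : path (fun i j => 0 < kappa i j) (f a) (map f (iota a.+1 l)) /\
    path_weight (edge_charge rho) (f a) (map f (iota a.+1 l)) = X (a + l)%N - X a.
  elim: l a => [|l IHl] a /=; first by rewrite addn0 subrr.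
  have [-> ->] := IHl a.+1; rewrite ef; split=> //.
  have -> : X a.+1 = X a + edge_charge rho (f a) (f a.+1).
    by rewrite /X big_ord_recr.
  by rewrite addSnnS; ring.
have lastE l a : last (f a) (map f (iota a.+1 l)) = f (a + l)%N.
  by elim: l a => [|l IHl] a; rewrite ?addn0 //= IHl addSnnS.
have funiq a l : (l <= m.+1)%N -> uniq (map f (iota a l)).
  move=> le_l; rewrite map_inj_in_uniq ?iota_uniq // => x y.
  rewrite !mem_iota => xa ya /(congr1 val) /= /eqP xy; move: xy.
  wlog le_yx : x y xa ya / (y <= x)%N.
    by case: (leqP y x) => [le|/ltnW le] H; [|rewrite eq_sym => /H/esym]; auto.
  rewrite eqn_mod_dvd // => /dvdn_leq; case: (posnP (x - y)) => [|_ /(_ isT)]; lia.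
(* A full turn is the Hamiltonian cycle itself, of charge 2. *)
have XS k : X (k + m.+1)%N = X k + 2.
  have [ek kE] := XE m.+1 k; apply/eqP; rewrite addrC -subr_eq -kE; apply/eqP.
  apply: (Rcharge_closed_path rhoP ek) => //; last exact: funiq.
  by rewrite lastE; apply: val_inj; rewrite /= modnDr.
(* [pos i] is the representative of [i] modulo [m.+1] in [r, r + m.+1). *)
pose pos (i : 'I_m.+1) := (r + (i + (m.+1 - r)) %% m.+1)%N.
have fpos i : f (pos i) = i.
  apply: val_inj; rewrite /= modnDmr addnCA subnKC ?modnDr ?modn_small //.
  exact: ltnW.
have pos_lt i : (r <= pos i < r + m.+1)%N by rewrite leq_addr ltn_add2l ltn_pmod.
exists (fun i => X (pos i)) => i j kij.
have neq_pos : pos i != pos j.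
  apply: contraTneq kij => /(congr1 f); rewrite !fpos => ->.
  by have := kA j j; lia.
have -> : cyclic_lt r j i = (pos j < pos i)%N by rewrite ltn_add2l.
(* [k] is the first representative of [i] after [pos j]. *)
have [k [kf kX]] : exists k, [/\ f k = i,
    X k = X (pos i) + 2 - 2 * (pos j < pos i)%N%:R & (pos j < k < pos j + m.+1)%N].
  have := pos_lt i; have := pos_lt j.
  case: (ltngtP (pos j) (pos i)) neq_pos => // ltij _ pj pi.
    by exists (pos i); split; rewrite ?fpos //; [rewrite mulr1 addrK | lia].
  exists (pos i + m.+1)%N; split; last by lia.
    by rewrite -[RHS]fpos; apply: val_inj; rewrite /= modnDr.
  by rewrite XS mulr0 subr0.
move=> k_bd.
have [ep pE] := XE (k - pos j)%N (pos j).
have jk : (pos j + (k - pos j))%N = k by lia.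
have := Rcharge_closed_path (i := j)
  (p := rcons (map f (iota (pos j).+1 (k - pos j))) j) rhoP.
rewrite rcons_path path_weight_rcons.
have := lastE (k - pos j)%N (pos j); rewrite jk fpos kf => ->.
move: ep pE; rewrite fpos jk => -> ->.
rewrite kij last_rcons => /(_ isT erefl) H.
have {}H : X k - X (pos j) + edge_charge rho i j = 2.
  apply: H; last by case: (map _ _).
  have := funiq (pos j) (k - pos j).+1; rewrite /= fpos rcons_uniq; apply; lia.
by move: H; rewrite kX => *; lra.
Qed.

(** * Pairing the flow with the potential *)

Lemma cyclic_lt_total (n : nat) (r i j : 'I_n) :
  i != j -> cyclic_lt r i j = ~~ cyclic_lt r j i.
Proof.
move=> ij; rewrite /cyclic_lt -leqNgt ltn_neqAle eqn_modDr.
by rewrite (modn_small (ltn_ord i)) (modn_small (ltn_ord j)) (inj_eq val_inj) ij.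
Qed.

Lemma antisymmetric_mxii (n : nat) (kappa : 'M[int]_n) i :
  antisymmetric_mx kappa -> kappa i i = 0.
Proof. by move/(_ i i); lia. Qed.

Lemma flow_cyclic_sum_ge0 (R : realType) (m : nat) (kappa : 'M[int]_m.+1)
    (rho : arrow kappa -> R) (r : 'I_m.+1) (u d : 'I_m.+1 -> 'I_m.+1 -> R) :
  antisymmetric_mx kappa -> is_Rcharge rho -> labelled_hamiltonian kappa ->
  (forall i, d i i = 0) -> (forall i j, d i j = d j i) ->
  (forall i j k, d i k <= d i j + d j k) ->
  (forall i j, u i j = u j i) ->
  (forall i j, kappa i j != 0 -> u i j * d i j = 1) ->
  (forall i, \sum_(j < m.+1 | (j != i) && (kappa i j != 0))
     (kappa i j)%:~R * u i j = 0) ->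
  0 <= \sum_(i < m.+1) \sum_(j < m.+1 | cyclic_lt r i j) kappa i j.
Proof.
move=> kA rhoP ham dii dC dD uC ud1 flow0.
have [X rhoE] := Rcharge_cyclic r kA rhoP ham.
pose b i j := cyclic_lt r j i.
pose c i j := if b i j then - d i j else d i j.
have c_ge0 i p : path (fun i j => 0 < kappa i j) i p -> last i p = i -> uniq p ->
    0 <= path_weight c i p.
  move=> ep lp up; case: (eqVneq p [::]) => [->//|p0].
  suff b1 : path_weight (fun i j => (b i j)%:R) i p = 1 :> R.
    by have := one_backward_ge dii dC dD b1; rewrite lp dii oppr0.
  (* The coboundary cancels on a closed path, leaving twice the number of backward edges equal to
     2. *)
  have := Rcharge_closed_path rhoP ep lp up p0.
  rewrite (path_weight_coboundary rhoE ep) lp subrr add0r => b2.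
  have path_weightZ (a : R) (f : 'I_m.+1 -> 'I_m.+1 -> R) :
      path_weight (fun i j => a * f i j) i p = a * path_weight f i p.
    elim: p i {ep lp up p0 b2} => [|j p IHp] i /=; first by rewrite mulr0.
    by rewrite IHp mulrDr.
  by move: b2; rewrite path_weightZ /b => b2; lra.
have [v vP] := feasible_potential c_ge0.
pose phi i j : R := (kappa i j)%:~R * u i j.
have phi0 i : \sum_j phi i j = 0.
  rewrite -[RHS](flow0 i) [RHS]big_mkcond; apply: eq_bigr => j _.
  case: eqVneq => [->|_] /=; first by rewrite /phi antisymmetric_mxii // mul0r.
  by case: eqVneq => [k0|//]; rewrite /phi k0 mul0r.
have phiC i j : phi i j = - phi j i by rewrite /phi kA uC rmorphN mulNr.
have cC i j : c i j = - c j i.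
  case: (eqVneq i j) => [->|ij]; first by rewrite /c dii oppr0 if_same oppr0.
  by rewrite /c /b (cyclic_lt_total _ ij) dC; case: ifP => /=; rewrite ?opprK.
have phid i j : phi i j * d i j = (kappa i j)%:~R.
  case: (eqVneq (kappa i j) 0) => [k0|k0]; first by rewrite /phi k0 !mul0r.
  by rewrite /phi -mulrA ud1 ?mulr1.
have d_ge0 i j : 0 <= d i j by have := dD i j i; rewrite dii (dC j i); lra.
have gain_ge0 i j : 0 < kappa i j -> 0 <= phi i j * (c i j + v j - v i).
  move=> kij; rewrite mulr_ge0 //; last by have := vP i j kij; lra.
  have := phid i j; have : (0 : R) < (kappa i j)%:~R by rewrite ltr0z.
  have := d_ge0 i j; nra.
(* Both factors are antisymmetric, so a reversed edge gives the same product. *)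
have gain_all i j : 0 <= phi i j * (c i j + v j - v i).
  case: (ltrgtP 0 (kappa i j)) => [kij|kij|k0]; first exact: gain_ge0.
    have := @gain_ge0 j i; rewrite kA oppr_gt0 => /(_ kij).
    by rewrite phiC cC; congr (0 <= _); ring.
  by rewrite /phi -k0 !mul0r.
have : 0 <= \sum_i \sum_j phi i j * (c i j + v j - v i).
  by apply: sumr_ge0 => i _; apply: sumr_ge0.
(* Conservation of [phi] removes the potential terms. *)
have -> : \sum_i \sum_j phi i j * (c i j + v j - v i)
    = \sum_i \sum_j phi i j * c i j.
  have phiv : \sum_i \sum_j phi i j * v i = 0.
    by apply: big1 => i _; rewrite -mulr_suml phi0 mul0r.
  have phiv' : \sum_i \sum_j phi i j * v j = 0.
    rewrite exchange_big; apply: big1 => j _ /=; rewrite -mulr_suml.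
    by under eq_bigr do rewrite phiC; rewrite sumrN phi0 oppr0 mul0r.
  transitivity (\sum_i (\sum_j phi i j * c i j + \sum_j phi i j * v j
                         - \sum_j phi i j * v i)).
    apply: eq_bigr => i _; rewrite -big_split -sumrB /=.
    by apply: eq_bigr => j _; ring.
  by rewrite sumrB big_split /= phiv phiv' subr0 addr0.
set S := (X in 0 <= X -> _); set K := (X in _ -> 0 <= X).
(* Each unordered pair occurs in both orders, with equal contributions. *)
suff -> : S = 2 * K%:~R by rewrite pmulr_rge0 // ler0z.
have KE : K = \sum_i \sum_j (if cyclic_lt r i j then kappa i j else 0).
  by apply: eq_bigr => i _; rewrite big_mkcond.
have KE' : K = \sum_i \sum_j (if b i j then - kappa i j else 0).
  rewrite KE exchange_big; apply: eq_bigr => i _; apply: eq_bigr => j _ /=.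
  by rewrite kA.
have -> : 2 * K%:~R = (K + K)%:~R :> R by rewrite rmorphD /=; ring.
rewrite {1}KE KE' -big_split rmorph_sum; apply: eq_bigr => i _ /=.
rewrite -big_split rmorph_sum; apply: eq_bigr => j _ /=.
case: (eqVneq i j) => [->|ij].
  by rewrite /phi antisymmetric_mxii // oppr0 !if_same addr0 !mul0r.
rewrite /c /b (cyclic_lt_total _ ij); case: ifP => _ /=.
  by rewrite mulrN phid add0r rmorphN.
by rewrite phid addr0.
Qed.

(** The function [t / (1 + t)], inverse to the attractor factor [1 + 1 / t], is increasing and
    subadditive for [t >= 0]. *)
Lemma edist_bounded_triangle (R : realType) (x y z : 'rV[R]_3) :
  edist x z / (1 + edist x z) <=
  edist x y / (1 + edist x y) + edist y z / (1 + edist y z).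
Proof.
have := edist_triangle x y z.
move: (edist x z) (edist x y) (edist y z)
  (edist_ge0 x z) (edist_ge0 x y) (edist_ge0 y z) => c a b c0 a0 b0 cab.
rewrite -subr_ge0.
have -> : a / (1 + a) + b / (1 + b) - c / (1 + c) =
    (a + b - c + a * b * (2 + c)) / ((1 + a) * (1 + b) * (1 + c)).
  by field; rewrite !gt_eqF //; lra.
by apply: divr_ge0; [have := mulr_ge0 a0 b0; nra | rewrite !mulr_ge0 //; lra].
Qed.

Theorem proposition2p4 (R : realType) (n : nat) (kappa : 'M[int]_n)
  (kappa_anti : antisymmetric_mx kappa)
  (kappa_Rcharge : exists rho : arrow kappa -> R, is_Rcharge rho)
  (kappa_ham : labelled_hamiltonian kappa)
  (kappa_sol :
     (exists r : 'I_n -> 'rV[R]_3, scaling_solution kappa r) \/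
     (exists r : 'I_n -> 'rV[R]_3, attractor_solution kappa r)) :
  0 <= \sum_(i < n) \sum_(j < n | (i < j)%N) kappa i j /\
  forall r : 'I_n,
    0 <= \sum_(i < n) \sum_(j < n | cyclic_lt r i j) kappa i j.
Proof.
case: n => [|m] in kappa kappa_anti kappa_Rcharge kappa_ham kappa_sol *.
  by split=> [|[]//]; rewrite big_ord0.
have [rho rhoP] := kappa_Rcharge.
suff all_r r : 0 <= \sum_(i < m.+1) \sum_(j < m.+1 | cyclic_lt r i j) kappa i j.
  (* The usual order is the cyclic order starting at node 0. *)
  split=> //; have := all_r ord0; congr (0 <= _).
  apply: eq_bigr => i _; apply: eq_bigl => j.
  by rewrite /cyclic_lt subn0 !modnDr !modn_small.
have [[x [x_neq x0]]|[x [x_neq x0]]] := kappa_sol.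
  apply: (flow_cyclic_sum_ge0 r (u := fun i j => (edist (x i) (x j))^-1)
    (d := fun i j => edist (x i) (x j)) kappa_anti rhoP kappa_ham) => //.
  - by move=> i; rewrite edistxx.
  - by move=> i j; rewrite edistC.
  - by move=> i j k; apply: edist_triangle.
  - by move=> i j; rewrite edistC.
  - by move=> i j /x_neq/edist_gt0/gt_eqF xij; rewrite mulVf ?xij.
apply: (flow_cyclic_sum_ge0 r (u := fun i j => 1 + (edist (x i) (x j))^-1)
  (d := fun i j => edist (x i) (x j) / (1 + edist (x i) (x j)))
  kappa_anti rhoP kappa_ham) => //.
- by move=> i; rewrite edistxx mul0r.
- by move=> i j; rewrite edistC.
- by move=> i j k; apply: edist_bounded_triangle.
- by move=> i j; rewrite edistC.
- move=> i j /x_neq/edist_gt0; move: (edist _ _) => t t0.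
  by field; rewrite !gt_eqF //; lra.
Qed.
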